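(* Let $(G,\cdot,\rhd)$ be an inner post-group, with sub-adjacent group $(G,\circ)$ and with $Z(G)$ the center of $(G,\cdot)$. Then $(G,\cdot,\rhd)$ is induced by a Rota-Baxter operator of weight $1$ on the group $(G,\cdot)$, i.e. there is a Rota-Baxter operator $\mathcal B:G\to G$ on $(G,\cdot)$ with $a\rhd b=\mathcal B(a)\cdot b\cdot\mathcal B(a)^{-1}$ for all $a,b\in G$, if and only if its obstruction class $[\omega]\in H^2((G,\circ),Z(G))$ is trivial.
   Context: A post-group $(G,\cdot,\rhd)$ is a group $(G,\cdot)$ with a multiplication $\rhd:G\times G\to G$ such that for each $a\in G$ the map $L^\rhd(a):G\to G$, $L^\rhd(a)(b)=a\rhd b$, is an automorphism of $(G,\cdot)$, and $(a\cdot(a\rhd b))\rhd c=a\rhd(b\rhd c)$ for all $a,b,c\in G$. Then $a\circ b=a\cdot(a\rhd b)$ defines a group $(G,\circ)$, called the sub-adjacent group, and $L^\rhd$ is an action of $(G,\circ)$ on $(G,\cdot)$ by automorphisms. The post-group is inner if $L^\rhd(a)$ is an inner automorphism of $(G,\cdot)$ for every $a\in G$. Inverses $(\;)^{-1}$ are taken in $(G,\cdot)$, and $\mathrm{Ad}_a b=a\cdot b\cdot a^{-1}$. A Rota-Baxter operator (of weight $1$) on a group $(G,\cdot)$ is a map $\mathcal B:G\to G$ with $\mathcal B(a)\cdot\mathcal B(b)=\mathcal B(a\cdot\mathrm{Ad}_{\mathcal B(a)}b)$ for all $a,b\in G$. Obstruction class: for an inner post-group choose a map $\Phi:G\to G$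 with $L^\rhd(a)=\mathrm{Ad}_{\Phi(a)}$ for all $a\in G$. Define $\omega:G\times G\to Z(G)$ by $\omega(a,b)=\Phi(b)^{-1}\cdot\Phi(a)^{-1}\cdot\Phi(a\circ b)$. This is a $2$-cocycle on the group $(G,\circ)$ with coefficients in $Z(G)$ with trivial action, i.e. $\omega(b,c)\cdot\omega(a,b\circ c)=\omega(a,b)\cdot\omega(a\circ b,c)$, and its class $[\omega]\in H^2((G,\circ),Z(G))$ (group cohomology, trivial action) does not depend on the choice of $\Phi$; it is called the obstruction class. It is trivial iff there is a map $\zeta:G\to Z(G)$ with $\omega(a,b)=\zeta(a)\cdot\zeta(b)\cdot\zeta(a\circ b)^{-1}$ for all $a,b\in G$. *)

(* Defs.v *)
From HB Require Import structures.
From mathcomp Require Import all_boot boolp.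

Set Implicit Arguments.
Unset Strict Implicit.
Unset Printing Implicit Defensive.

Local Open Scope group_scope.
Local Open Scope quotient_scope.

Definition Ad (G : groupType) (a b : G) : G := a * b * a^-1.

Definition inner_automorphism (G : groupType) (f : G -> G) : Prop :=
  exists g : G, forall b, f b = Ad g b.

Section Center.
Variable G : groupType.

Definition central : {pred G} := fun z => `[< forall x, z * x = x * z >].

Lemma centralP z : reflect (forall x, z * x = x * z) (z \in central).
Proof. exact: asboolP. Qed.

Lemma central_group_closed : group_closed central.
Proof.
split=> [|y z /centralP cy /centralP cz]; apply/centralP => x.
  by rewrite mul1g mulg1.
have cz' : z^-1 * x = x * z^-1.
  by apply: (mulgI z); rewrite mulgA mulgV mul1g mulgA cz -mulgA mulgV mulg1.
by rewrite -mulgA cz' mulgA cy mulgA.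
Qed.

Definition center := {z : G | z \in central}.
HB.instance Definition _ := Choice.on center.
HB.instance Definition _ := SubType.on center.
HB.instance Definition _ :=
  SubChoice_isSubGroup.Build G central center central_group_closed.

Lemma center_mulgC : commutative (@mul center).
Proof. by move=> x y; apply/val_inj/(centralP _ (valP x)). Qed.

End Center.
Arguments central : clear implicits.

HB.mixin Record Group_isAbelian A of Group A := {
  abelian_mulgC : commutative (@mul A)
}.
#[short(type="abelianGroupType")]
HB.structure Definition AbelianGroup := {A of Group_isAbelian A & Group A}.

HB.instance Definition _ (G : groupType) :=
  Group_isAbelian.Build (center G) (@center_mulgC G).

(* H^2(H, A) for the trivial action of H on A, by inhomogeneous cochains. *)
Section SecondCohomology.
Variables (H : groupType) (A : abelianGroupType).

Definition cocycle2 (f : H -> H -> A) : Prop :=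
  forall a b c, f b c * f a (b * c) = f a b * f (a * b) c.

Definition coboundary (zeta : H -> A) : H -> H -> A :=
  fun a b => zeta a * zeta b * (zeta (a * b))^-1.

Definition Z2 := {f : H -> H -> A | `[< cocycle2 f >]}.
HB.instance Definition _ := Choice.on Z2.
HB.instance Definition _ := SubType.on Z2.

Lemma cocycle2_1 : cocycle2 (fun _ _ => 1).
Proof. by []. Qed.

Definition Z2_1 : Z2 := Sub (fun _ _ => 1) (asboolT cocycle2_1).

Definition cohomologous (f g : Z2) : bool :=
  `[< exists zeta : H -> A,
        forall a b, val f a b = val g a b * coboundary zeta a b >].

Lemma cohomologous_refl : reflexive cohomologous.
Proof.
move=> f; apply/asboolP; exists (fun _ => 1) => a b.
by rewrite /coboundary !mulg1 mulgV mulg1.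
Qed.

Lemma coboundaryV zeta a b :
  coboundary (fun x => (zeta x)^-1) a b = (coboundary zeta a b)^-1.
Proof. by rewrite /coboundary !invgM abelian_mulgC (abelian_mulgC (zeta a)^-1). Qed.

Lemma coboundaryM zeta xi a b :
  coboundary (fun x => zeta x * xi x) a b
  = coboundary zeta a b * coboundary xi a b.
Proof.
rewrite /coboundary invgM.
have AC := @abelian_mulgC A; have ACA : interchange (@mul A) (@mul A).
  by move=> x y z t; rewrite !mulgA -(mulgA x) (AC y) mulgA.
by rewrite (ACA _ (xi a)) (AC (xi (a * b))^-1) [LHS]ACA.
Qed.

Lemma cohomologous_sym : symmetric cohomologous.
Proof.
have sub f g : cohomologous f g -> cohomologous g f.
  case/asboolP=> zeta fg; apply/asboolP; exists (fun x => (zeta x)^-1) => a b.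
  by rewrite coboundaryV fg mulgK.
by move=> f g; apply/idP/idP; apply: sub.
Qed.

Lemma cohomologous_trans : transitive cohomologous.
Proof.
move=> g f h /asboolP[zeta fg] /asboolP[xi gh]; apply/asboolP.
exists (fun x => xi x * zeta x) => a b.
by rewrite coboundaryM mulgA -gh fg.
Qed.

Canonical cohomologous_equiv :=
  EquivRel cohomologous cohomologous_refl cohomologous_sym cohomologous_trans.

Definition H2 : Type := {eq_quot cohomologous}.

Definition H2_class (f : Z2) : H2 := \pi_({eq_quot cohomologous}) f.

(* The neutral element of H^2. *)
Definition H2_1 : H2 := H2_class Z2_1.

Lemma H2_classP (f g : Z2) : H2_class f = H2_class g <->
  exists zeta : H -> A,
    forall a b, val f a b = val g a b * coboundary zeta a b.
Proof.
split=> [/eqmodP|fg]; first by move/asboolP.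
by apply/eqmodP/asboolP.
Qed.

Lemma H2_class_triv (f : Z2) : H2_class f = H2_1 <->
  exists zeta : H -> A, forall a b, val f a b = coboundary zeta a b.
Proof.
rewrite H2_classP; split=> -[zeta E]; exists zeta => a b.
  by rewrite E mul1g.
by rewrite mul1g E.
Qed.

End SecondCohomology.

HB.mixin Record Group_isPostGroup G of Group G := {
  rhd : G -> G -> G;
  rhdM : forall a, {morph rhd a : b c / b * c};
  rhd_bij : forall a, bijective (rhd a);
  rhdA : forall a b c, rhd (a * rhd a b) c = rhd a (rhd b c)
}.
#[short(type="postGroupType")]
HB.structure Definition PostGroup := {G of Group_isPostGroup G & Group G}.

Notation "a |> b" := (rhd a b) (at level 40, left associativity) : group_scope.

(* A type alias of G, carrying the sub-adjacent group structure (G, o). *)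
Definition subadjacent (G : postGroupType) : Type := G.

Section SubAdjacent.
Variable G : postGroupType.
Implicit Types a b c : G.

Definition circ a b : G := a * (a |> b).

Lemma rhd_g1 a : a |> 1 = 1.
Proof. by apply: (mulgI (a |> 1)); rewrite -rhdM !mulg1. Qed.

Lemma rhd_1g a : 1 |> a = a.
Proof.
have [f fK _] := rhd_bij (1 : G); apply: (can_inj fK).
by rewrite -rhdA rhd_g1 mulg1.
Qed.

Lemma circA : associative circ.
Proof. by move=> a b c; rewrite /circ rhdM rhdA mulgA. Qed.

Lemma circ1g : left_id 1 circ.
Proof. by move=> a; rewrite /circ rhd_1g mul1g. Qed.

Lemma circg1 : right_id 1 circ.
Proof. by move=> a; rewrite /circ rhd_g1 mulg1. Qed.

Lemma circ_inv_subproof a : exists b, a |> b == a^-1.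
Proof. by have [f _ fK] := rhd_bij a; exists (f a^-1); rewrite fK. Qed.

Definition circ_inv a : G := xchoose (circ_inv_subproof a).

Lemma circgV : right_inverse 1 circ_inv circ.
Proof.
by move=> a; rewrite /circ (eqP (xchooseP (circ_inv_subproof a))) mulgV.
Qed.

Lemma circVg : left_inverse 1 circ_inv circ.
Proof.
move=> a; rewrite -[LHS]circg1 -{1}(circgV (circ_inv a)) circA.
by rewrite -(circA (circ_inv a)) circgV circg1 circgV.
Qed.

HB.instance Definition _ := Choice.on (subadjacent G).
HB.instance Definition _ :=
  isGroup.Build (subadjacent G) circA circ1g circg1 circVg circgV.

Lemma subadjacent_mulE (a b : subadjacent G) : a * b = circ a b.
Proof. by []. Qed.

End SubAdjacent.

Definition inner_post_group (G : postGroupType) : Prop :=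
  forall a : G, inner_automorphism (rhd a).

Section Obstruction.
Variable G : postGroupType.

Definition inner_lift (Phi : G -> G) : Prop := forall a b, a |> b = Ad (Phi a) b.

Lemma inner_lift_exists : inner_post_group G -> exists Phi, inner_lift Phi.
Proof. by move=> innG; have [Phi] := choice innG; exists Phi. Qed.

Definition omega (Phi : G -> G) (a b : G) : G :=
  (Phi b)^-1 * (Phi a)^-1 * Phi (circ a b).

Variables (Phi : G -> G) (PhiP : inner_lift Phi).

Lemma omega_central a b : omega Phi a b \in central G.
Proof.
apply/centralP => x; rewrite /omega.
have := rhdA a b x; rewrite -/(circ a b) !PhiP /Ad => E.
apply: (mulgI (Phi a * Phi b)); apply: (mulIg (Phi (circ a b))^-1).
move: E; rewrite !mulgA => E.
by rewrite mulgK mulgV mul1g E !mulgK.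
Qed.

Definition omegaZ (a b : subadjacent G) : center G :=
  Sub (omega Phi a b) (omega_central a b).

Lemma omegaZ_cocycle : cocycle2 omegaZ.
Proof.
move=> a b c; apply: val_inj; rewrite !valM /= !subadjacent_mulE.
have -> : omega Phi a b * omega Phi (circ a b) c
    = (Phi c)^-1 * omega Phi a b * ((Phi (circ a b))^-1 * Phi (circ a (circ b c))).
  rewrite -(centralP _ (omega_central a b) (Phi c)^-1) -!mulgA; congr (_ * _).
  by rewrite circA /omega -!mulgA.
by rewrite /omega !mulgA !mulgK.
Qed.

Definition obstruction_cocycle : Z2 (subadjacent G) (center G) :=
  Sub omegaZ (asboolT omegaZ_cocycle).

End Obstruction.

Section ObstructionClass.
Variables (G : postGroupType) (innG : inner_post_group G).

Definition obstruction_class : H2 (subadjacent G) (center G) :=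
  H2_class (obstruction_cocycle (projT2 (cid (inner_lift_exists innG)))).

Lemma obstruction_classE (Phi : G -> G) (PhiP : inner_lift Phi) :
  obstruction_class = H2_class (obstruction_cocycle PhiP).
Proof.
rewrite /obstruction_class; case: cid => Psi /= PsiP.
have PhiPsi_central a : (Phi a)^-1 * Psi a \in central G.
  apply/centralP => x; apply: (mulgI (Phi a)); apply: (mulIg (Psi a)^-1).
  have := PhiP a x; rewrite PsiP /Ad => E.
  by rewrite !mulgA mulgV mul1g E mulgK.
have [zeta PsiE] : exists zeta : subadjacent G -> center G,
    forall a : G, Psi a = Phi a * (val (zeta a))^-1.
  exists (fun a => (Sub ((Phi a)^-1 * Psi a) (PhiPsi_central a) : center G)^-1).
  by move=> a; rewrite invgK mulgA mulgV mul1g.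
have valC (z : center G) x : val z * x = x * val z.
  exact: (centralP _ (valP z)).
apply/H2_classP; exists zeta => a b; apply: val_inj.
have valV (z : center G) : val z^-1 = (val z)^-1 by [].
rewrite /coboundary !valM valV /= /omega subadjacent_mulE !PsiE !invgM !invgK.
rewrite valC -!mulgA; congr (_ * _).
rewrite [LHS]valC [X in X * _]valC -!mulgA; do 2!congr (_ * _).
by rewrite -valV valC mulgA.
Qed.

End ObstructionClass.

Definition rota_baxter (G : groupType) (B : G -> G) : Prop :=
  forall a b, B a * B b = B (a * Ad (B a) b).

(* Main.v *)
Require Import Defs.
From HB Require Import structures.
From mathcomp Require Import all_boot boolp.

(** A Rota-Baxter operator inducing [|>] is the same thing as a lift [B] of
    [a |-> rhd a] through [Ad : G -> Inn G] that is a group morphism from the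
    sub-adjacent group to [G] ([rota_baxter_lift]).  The cochain [omega Phi] measures the failure of a
    lift [Phi] to be such a morphism.  A multiplicative lift therefore yields
    the trivial cocycle, and the class can be computed with any lift.
    Conversely, lifts may be multiplied by central factors without changing
    the action by conjugation ([inner_lift_mul_center]); if [omega Phi] is the
    coboundary of [zeta], then multiplying [Phi] by [zeta] makes it
    multiplicative, because central factors can be collected on the right. *)

Local Open Scope group_scope.

(** The Rota-Baxter identity for [B] is multiplicativity with respect to [circ]
    when [|>] is conjugation by [B], because [circ a b] unfolds to
    [a * Ad (B a) b]. *)
Lemma rota_baxter_lift (G : postGroupType) (B : G -> G) : inner_lift B ->
  rota_baxter B <-> forall a b, B a * B b = B (circ a b).
Proof.
by move=> BP; split=> BM a b; rewrite BM /circ BP.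
Qed.

Lemma center_comm (G : groupType) (z : center G) (x : G) :
  val z * x = x * val z.
Proof. exact: (centralP _ (valP z)). Qed.

(** Elements of [G] that differ by a central factor have the same conjugation
    action; this is the freedom used to turn a lift into a morphism. *)
Lemma inner_lift_mul_center (G : postGroupType) (Phi : G -> G)
    (zeta : G -> center G) :
  inner_lift Phi -> inner_lift (fun a => Phi a * val (zeta a)).
Proof.
move=> PhiP a b; rewrite PhiP /Ad invgM -!mulgA; congr (_ * _).
by rewrite [RHS]mulgA center_comm -mulgA mulVKg.
Qed.

(** The equation defining [omega], solved for its last factor: the form in which
    it compares [Phi (circ a b)] with [Phi a * Phi b]. *)
Lemma circ_lift_omega (G : postGroupType) (Phi : G -> G) (a b : G) :
  Phi (circ a b) = Phi a * Phi b * omega Phi a b.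
Proof. by rewrite /omega !mulgA mulgK mulgV mul1g. Qed.

Theorem theorem3p11 (G : postGroupType) (innG : inner_post_group G) :
  (exists B : G -> G,
      rota_baxter B /\ forall a b : G, a |> b = B a * b * (B a)^-1)
  <-> obstruction_class innG = H2_1 (subadjacent G) (center G).
Proof.
split=> [[B [RB BP]]|].
  have BL : inner_lift B := BP.
  have BM := (rota_baxter_lift _ _ BL).1 RB.
  rewrite (obstruction_classE innG BL); apply/H2_class_triv.
  exists (fun=> 1) => a b; rewrite /coboundary mulg1 mulgV.
  by apply: val_inj; rewrite /= /omega -BM -invgM mulVg.
have [Phi PhiP] := inner_lift_exists innG.
rewrite (obstruction_classE innG PhiP) => /H2_class_triv[zeta omegaE].
have BL := inner_lift_mul_center _ _ zeta PhiP.
exists (fun a => Phi a * val (zeta a)); split; last exact: BL.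
apply/(rota_baxter_lift _ _ BL) => a b.
have omegaM :
    omega Phi a b * val (zeta (circ a b)) = val (zeta a) * val (zeta b).
  have /(congr1 val) /= -> := omegaE a b.
  by rewrite /coboundary subadjacent_mulE mulgVK.
rewrite circ_lift_omega -[RHS]mulgA omegaM.
by rewrite -!mulgA; congr (_ * _); rewrite !mulgA center_comm.
Qed.
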